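(* Let $n$ and $k$ be positive integers with $n\ge k+\lceil n/3\rceil$. For the path graph $P_n$, $$Sb_k(P_n)=\begin{cases}\left\lfloor\frac{3k-1}{2}\right\rfloor, & n\equiv 0\pmod 3,\\[2pt] \left\lfloor\frac{3k+1}{2}\right\rfloor, & n\equiv 1\pmod 3,\\[2pt] \left\lceil\frac{3k-1}{2}\right\rceil, & n\equiv 2\pmod 3.\end{cases}$$
   Context: $\gamma(G)$ is the domination number of $G$ (minimum size of a dominating set); $\gamma(P_n)=\lceil n/3\rceil$. For a positive integer $k$, $Sb_k(G)$ is the minimum size of a set $\mathcal{E}$ of edges of $G$ such that $\gamma(G-\mathcal{E})=\gamma(G)+k$. *)

(* Defs.v *)
From mathcomp Require Import all_boot.
Set Implicit Arguments.
Unset Strict Implicit.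
Unset Printing Implicit Defensive.

Record sgraph (V : finType) := SGraph {
  adj : rel V;
  adj_sym : symmetric adj;
  adj_irr : irreflexive adj }.

Section Graphs.
Variables (V : finType) (G : sgraph V).

(** An edge is encoded as the unordered pair of its two endpoints. *)
Definition edges : {set {set V}} :=
  [set [set p.1; p.2] | p : V * V & adj G p.1 p.2].

Definition del_rel (E : {set {set V}}) : rel V :=
  fun x y => adj G x y && ([set x; y] \notin E).

Lemma del_rel_sym (E : {set {set V}}) : symmetric (del_rel E).
Proof. by move=> x y; rewrite /del_rel adj_sym setUC. Qed.

Lemma del_rel_irr (E : {set {set V}}) : irreflexive (del_rel E).
Proof. by move=> x; rewrite /del_rel adj_irr. Qed.

Definition del_edges (E : {set {set V}}) : sgraph V :=
  SGraph (del_rel_sym E) (@del_rel_irr E).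

Definition dominating (D : {set V}) : bool :=
  [forall v, (v \in D) || [exists u in D, adj G u v]].

(** The whole vertex set is always dominating, so the minimum below is
    attained at a dominating set. *)
Definition domination_number : nat :=
  #|[arg min_(D < [set: V] | dominating D) #|D|]|.

End Graphs.

Definition raises_domination (V : finType) (G : sgraph V) (k : nat)
    (E : {set {set V}}) : Prop :=
  E \subset edges G /\
  domination_number (del_edges G E) = domination_number G + k.

(** [is_Sb G k m] states that Sb_k(G) is defined and equals [m]; it is a relation
    because for a general graph and [k] no suitable edge set need exist. *)
Definition is_Sb (V : finType) (G : sgraph V) (k m : nat) : Prop :=
  (exists2 E : {set {set V}}, raises_domination G k E & #|E| = m) /\
  (forall E : {set {set V}}, raises_domination G k E -> m <= #|E|).

Definition path_rel (n : nat) : rel 'I_n :=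
  fun i j => (i.+1 == j :> nat) || (j.+1 == i :> nat).

Lemma path_rel_sym (n : nat) : symmetric (@path_rel n).
Proof. by move=> i j; rewrite /path_rel orbC. Qed.

Lemma path_rel_irr (n : nat) : irreflexive (@path_rel n).
Proof. by move=> i; rewrite /path_rel orbb gtn_eqF. Qed.

Definition path_graph (n : nat) : sgraph 'I_n :=
  SGraph (@path_rel_sym n) (@path_rel_irr n).

(** Ceiling of [m / d], for [0 < d]. *)
Definition ceil_div (m d : nat) : nat := (m + d.-1) %/ d.

(* Main.v *)
(** Sort the vertices of [P_n] by residue mod 3.  To make a residue class
    dominating in [P_n - E] it suffices to add the vertices whose neighbour in
    that class has been cut off.  Over the three classes this adds one vertex for
    each missing right neighbour and one for each missing left neighbour, at most
    [2|E| + 2] in all, whence [3 gamma(P_n - E) <= n + 2|E| + 2].  Conversely a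
    vertex dominates at most three vertices, and after the first [m] edges are
    deleted the first [m] vertices are isolated, so that
    [n + 2m <= 3 gamma].  Hence [gamma] is the only integer allowed by these
    bounds when the first [m] edges are deleted, and this deletion is optimal. *)
Require Import Defs.
From mathcomp Require Import all_boot.
From mathcomp Require Import zify.

Section Domination.
Context {V : finType} (G : sgraph V).

Lemma dominatingT : dominating G [set: V].
Proof. by apply/forallP => v; rewrite in_setT. Qed.

Lemma domination_number_le (D : {set V}) :
  dominating G D -> domination_number G <= #|D|.
Proof.
rewrite /domination_number; case: arg_minnP => [|D0 _ D0min]; first exact: dominatingT.
exact: D0min.
Qed.

Lemma domination_numberP :
  exists2 D : {set V}, dominating G D & #|D| = domination_number G.
Proof.
rewrite /domination_number; case: arg_minnP => [|D domD _]; first exact: dominatingT.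
by exists D.
Qed.

Lemma domination_number_del (E : {set {set V}}) :
  domination_number G <= domination_number (del_edges G E).
Proof.
rewrite {2}/domination_number; case: arg_minnP => [|D domD _].
  by apply/forallP => v; rewrite in_setT.
apply: domination_number_le; apply/forallP => v.
have /orP[->//|/exists_inP[u uD /andP[uv _]]] := forallP domD v.
by apply/orP; right; apply/exists_inP; exists u.
Qed.

End Domination.

Section PathEdges.
Context {n : nat}.
Implicit Types u v w : 'I_n.

(** These index the edges of the path by one endpoint. At the end of the path the value is a
    singleton instead of an edge, so both maps are total and still injective. *)
Definition edge_right v : {set 'I_n} := [set x : 'I_n | v <= x <= v.+1].
Definition edge_left v : {set 'I_n} := [set x : 'I_n | x <= v <= x.+1].

Lemma edge_right_inj : injective edge_right.
Proof.
move=> v w /setP eq_vw; apply: val_inj => /=.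
by have := eq_vw v; have := eq_vw w; rewrite !inE; lia.
Qed.

Lemma edge_left_inj : injective edge_left.
Proof.
move=> v w /setP eq_vw; apply: val_inj => /=.
by have := eq_vw v; have := eq_vw w; rewrite !inE; lia.
Qed.

Lemma edge_rightE u v : u.+1 = v -> [set u; v] = edge_right u.
Proof. by move=> uv; apply/setP => x; rewrite !inE -!val_eqE /=; lia. Qed.

Lemma edge_leftE u v : u.+1 = v -> [set u; v] = edge_left v.
Proof. by move=> uv; apply/setP => x; rewrite !inE -!val_eqE /=; lia. Qed.

End PathEdges.

Lemma sum_mem {T : finType} (A : {set T}) : \sum_x (x \in A) = #|A|.
Proof. by rewrite -sum1_card [RHS]big_mkcond. Qed.

Section UpperBound.
Context {n : nat} (E : {set {set 'I_n}}).
Let G := del_edges (path_graph n) E.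

Let no_right := [set v : 'I_n | ~~ [exists u, adj G u v && (v.+1 == u)]].
Let no_left := [set v : 'I_n | ~~ [exists u, adj G u v && (u.+1 == v)]].

(** The extra 1 pays for the last vertex; any other vertex in [no_right] has lost its own edge
    [edge_right v], which lies in [E]. *)
Lemma card_no_right : #|no_right| <= #|E|.+1.
Proof.
rewrite -(cardsID [set v : 'I_n | v.+1 == n]) -add1n leq_add //.
  apply/card_le1_eqP => v w; rewrite !inE => /andP[_ /eqP vn] /andP[_ /eqP wn].
  by apply: val_inj => /=; lia.
rewrite -(card_imset _ (@edge_right_inj n)); apply/subset_leq_card/subsetP => e.
case/imsetP => v; rewrite !inE => /andP[vn /existsPn noR] ->.
have vn' : v.+1 < n by have := ltn_ord v; lia.
have := noR (Ordinal vn'); rewrite /= /del_rel /= /path_rel /= eqxx orbT /= andbT negbK.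
by rewrite setUC edge_rightE.
Qed.

Lemma card_no_left : #|no_left| <= #|E|.+1.
Proof.
rewrite -(cardsID [set v : 'I_n | v == 0 :> nat]) -add1n leq_add //.
  apply/card_le1_eqP => v w; rewrite !inE => /andP[_ /eqP vn] /andP[_ /eqP wn].
  by apply: val_inj => /=; lia.
rewrite -(card_imset _ (@edge_left_inj n)); apply/subset_leq_card/subsetP => e.
case/imsetP => v; rewrite !inE => /andP[v0 /existsPn noL] ->.
have vn' : v.-1 < n by have := ltn_ord v; lia.
have uv : (Ordinal vn').+1 = v by rewrite /=; lia.
have := noL (Ordinal vn'); rewrite /= /del_rel /= /path_rel uv eqxx /= andbT negbK.
by rewrite (edge_leftE _ _ uv).
Qed.

(** The left neighbour of [v] has residue [v.+2 %% 3], a form that avoids truncated subtraction at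
    0. *)
Let repaired_class (r : nat) := [set v : 'I_n | [|| v %% 3 == r,
  (v.+1 %% 3 == r) && (v \in no_right) | (v.+2 %% 3 == r) && (v \in no_left)]].

Lemma dominating_repaired_class (r : nat) : r < 3 -> dominating G (repaired_class r).
Proof.
move=> r3; apply/forallP => v; rewrite [v \in repaired_class r]inE.
have [//|v_r] := eqVneq (v %% 3) r.
have [v1_r|v1_r] := eqVneq (v.+1 %% 3) r.
  rewrite [v \in no_right]inE; case: existsP => [[u /andP[uv /eqP vu]]|//].
  by apply/orP; right; apply/exists_inP; exists u; rewrite // inE -vu v1_r eqxx.
have v2_r : v.+2 %% 3 = r by lia.
rewrite v2_r eqxx [v \in no_left]inE; case: existsP => [[u /andP[uv /eqP vu]]|//].
apply/orP; right; apply/exists_inP; exists u => //.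
by rewrite inE; apply/orP; left; apply/eqP; lia.
Qed.

Lemma sum_card_repaired_class :
  \sum_(r < 3) #|repaired_class r| <= n + #|no_right| + #|no_left|.
Proof.
have -> : n + #|no_right| + #|no_left|
    = \sum_(v : 'I_n) (1 + (v \in no_right) + (v \in no_left)).
  by rewrite !big_split /= !sum_mem sum1_card card_ord.
under eq_bigr do rewrite -sum_mem.
(* Count per vertex: each of the three conditions on [v] holds for exactly one [r]. *)
rewrite exchange_big /=; apply: leq_sum => v _.
rewrite !big_ord_recl big_ord0 /= ![v \in repaired_class _]inE /bump /=.
by case: (v \in no_right); case: (v \in no_left); lia.
Qed.

Lemma domination_number_del_path :
  3 * domination_number G <= n + 2 * #|E| + 2.
Proof.
have le_sum : 3 * domination_number G <= \sum_(r < 3) #|repaired_class r|.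
  rewrite -[3 in X in X <= _]card_ord -sum_nat_const; apply: leq_sum => r _.
  exact/domination_number_le/dominating_repaired_class.
have := sum_card_repaired_class; have := card_no_right; have := card_no_left; lia.
Qed.

End UpperBound.

Lemma card_ord_lt {n m : nat} : m <= n -> #|[set v : 'I_n | v < m]| = m.
Proof.
move=> mn; rewrite -sum1dep_card -(big_ord_widen n (fun=> 1) mn).
by rewrite sum1_card card_ord.
Qed.

(** The closed neighbourhoods of [D] cover all [n] vertices. The first [m] vertices are isolated, so
    they all lie in [D], and each covers 2 fewer vertices than the maximum 3. *)
Lemma domination_number_isolated {n m : nat} (G : sgraph 'I_n) : m <= n ->
  (forall u v, adj G u v -> path_rel u v && (m <= u)) ->
  n + 2 * m <= 3 * domination_number G.
Proof.
move=> mn adjG; have [D domD <-] := domination_numberP G.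
pose N (u : 'I_n) := [set v | (v == u) || adj G u v].
have cardN u : #|N u| + 2 * (u < m) <= 3.
  case: ltnP => um.
    rewrite (_ : N u = [set u]) ?cards1 //; apply/setP => v; rewrite !inE.
    by case: (boolP (adj G u v)) => [/adjG|_]; rewrite ?orbF // leqNgt um andbF.
  rewrite addn0 cardE -(size_map val).
  (* The repetition in this list at [u = 0] is harmless: only its length matters. *)
  apply: (@uniq_leq_size _ _ [:: u.-1; val u; u.+1]).
    by rewrite (map_inj_uniq val_inj) enum_uniq.
  move=> _ /mapP[v + ->]; rewrite mem_enum !inE => /orP[/eqP->|/adjG].
    by rewrite eqxx orbT.
  by rewrite /path_rel /=; lia.
have coverN : n <= \sum_(u in D) #|N u|.
  rewrite -[X in X <= _]card_ord.
  under eq_bigr do rewrite -sum_mem.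
  rewrite exchange_big /= -sum1_card; apply: leq_sum => v _.
  suff [u uD vu] : exists2 u, u \in D & v \in N u by rewrite (bigD1 u) //= vu.
  have /orP[vD|/exists_inP[u uD uv]] := forallP domD v.
    by exists v; rewrite // inE eqxx.
  by exists u; rewrite // inE uv orbT.
have isolD : m <= \sum_(u in D) (u < m).
  rewrite -{1}(card_ord_lt mn) -sum1dep_card big_mkcond [leqRHS]big_mkcond /=.
  apply: leq_sum => v _; case: ifP => // vm.
  have /orP[->//|/exists_inP[u uD]] := forallP domD v.
  by rewrite adj_sym => /adjG; rewrite leqNgt vm andbF.
rewrite [3 * _]mulnC -sum_nat_const.
apply: (@leq_trans (\sum_(u in D) (#|N u| + 2 * (u < m)))); last exact: leq_sum.
by rewrite big_split /= -big_distrr leq_add // leq_mul.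
Qed.

Definition initial_edges (n m : nat) : {set {set 'I_n}} :=
  [set e in edges (path_graph n) | [exists x in e, x < m]].

Lemma card_initial_edges {n m : nat} : m <= n -> #|initial_edges n m| <= m.
Proof.
move=> mn; rewrite -{2}(card_ord_lt mn).
apply: leq_trans (leq_imset_card (@edge_right n) _).
apply/subset_leq_card/subsetP => e; rewrite inE => /andP[/imsetP[[u v] +]] /=.
rewrite inE /= => uv -> /exists_inP[x]; rewrite !inE -!val_eqE /= => xuv xm.
case/orP: uv => /eqP uv.
  by rewrite (edge_rightE _ _ uv); apply: imset_f; rewrite inE; lia.
by rewrite setUC (edge_rightE _ _ uv); apply: imset_f; rewrite inE; lia.
Qed.

Lemma del_initial_edges (n m : nat) (u v : 'I_n) :
  adj (del_edges (path_graph n) (initial_edges n m)) u v ->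
  path_rel u v && (m <= u).
Proof.
case/andP => /= uv; rewrite uv inE negb_and.
have -> /= : [set u; v] \in edges (path_graph n).
  by apply/imsetP; exists (u, v); rewrite ?inE.
by move/exists_inPn => /(_ u); rewrite !inE eqxx -leqNgt; apply.
Qed.

Theorem theorem7 (n k : nat) (n_gt0 : 0 < n) (k_gt0 : 0 < k)
    (n_ge : k + ceil_div n 3 <= n) :
  is_Sb (path_graph n) k
    (match n %% 3 with
     | 0 => (3 * k - 1) %/ 2
     | 1 => (3 * k + 1) %/ 2
     | _ => ceil_div (3 * k - 1) 2
     end).
Proof.
set m := (X in is_Sb _ _ X); set g := domination_number (path_graph n).
have g_ge : n <= 3 * g.
  have := @domination_number_isolated n 0 (path_graph n) (leq0n n).
  by rewrite muln0 addn0; apply=> u v /= ->.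
have g_le : 3 * g <= n + 2.
  have := domination_number_del (path_graph n) set0.
  by have := @domination_number_del_path n set0; rewrite cards0 -/g; lia.
have g_eq : g = ceil_div n 3 by rewrite /ceil_div; lia.
(* In each residue class [m] is the least integer satisfying the first bound; this yields
   [m_min]. *)
have m_bounds : 3 * (g + k) <= n + 2 * m + 2 /\ n + 2 * m <= 3 * (g + k).
  move: n_ge g_eq; rewrite /m /ceil_div /=.
  by case nmod: (n %% 3) => [|[|r]]; lia.
have m_min E : raises_domination (path_graph n) k E -> m <= #|E|.
  case=> _; have := @domination_number_del_path n E; rewrite -/g => + gE.
  rewrite {}gE; move: n_ge g_eq; rewrite /m /ceil_div /=.
  by case nmod: (n %% 3) => [|[|r]]; lia.
(* By the second bound, [n + 2 * m <= 3 * (g + k) <= 3 * n]. *)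
have mn : m <= n by move: n_ge; rewrite -g_eq; lia.
(* Three times the new domination number and [3 * (g + k)] both lie among the three consecutive
   integers from [n + 2 * m], so they agree. *)
have raiseE : raises_domination (path_graph n) k (initial_edges n m).
  split; first by apply/subsetP => e; rewrite inE => /andP[].
  have := domination_number_isolated _ mn (del_initial_edges n m).
  have := domination_number_del_path (initial_edges n m).
  have := card_initial_edges mn.
  rewrite -/g; lia.
split=> //; exists (initial_edges n m) => //.
(* Fewer than [m] edges would contradict minimality. *)
by apply/eqP; rewrite eqn_leq card_initial_edges // m_min.
Qed.
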